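(* Let $\theta,\rho\in(0,1)$ and let $\mathcal I$ be a local quadrature rule with positive weights that is exact for constants (i.e. $\sum_i w_i=\mathrm{vol}(K)$ on each box $K$). Let $\Omega\in\mathbb{IR}^d$ be a box with nonempty interior, $f:\Omega\to\mathbb R$ continuous, and $F$ an interval enclosure of $f$ that is Hölder continuous on $\Omega$ with constant $C>0$ and exponent $\gamma\in(0,1]$. Run AdaQuad with quadrature rule $\mathcal I$, marking rule $\mathrm{D\ddot orfler}_\theta$ and refinement rule $\mathrm{H\ddot older}_\rho$ (using $F,C,\gamma$). Then for all $n\in\mathbb N_0$ $$\Big|\int_\Omega f(x)\,dx-\mathrm Q_n\Big|\le\eta_n\quad\text{and}\quad \eta_{n+1}\le(1-\theta(1-\rho))\,\eta_n,$$ in particular $\eta_n\to0$.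
   Context: Intervals: $\mathbb{IR}=\{[\underline X,\overline X]\subset\mathbb R:\underline X\le\overline X\}$; $\mathbb{IR}^N$ denotes boxes $K=K_1\times\dots\times K_N$. Width $w([\underline X,\overline X])=\overline X-\underline X$, and for a box $w(K)=\max_iw(K_i)$. For a box $\Omega$ and $\phi:\Omega\to\mathbb R^m$, a map $F$ from boxes $K\subset\Omega$ to $\mathbb{IR}^m$ is an interval enclosure of $\phi$ if it is inclusion isotonic ($K'\subset K\Rightarrow F(K')\subset F(K)$) and $\phi(K)\subset F(K)$ for all boxes $K\subset\Omega$. $F$ is Hölder continuous on $\Omega$ with exponent $\gamma$ and constant $C$ if $w(F(K))\le Cw(K)^\gamma$ for all boxes $K\subset\Omega$. A local quadrature rule assigns $\mathcal I(f,K)=\sum_{i=1}^Nw_if(x_i)$ with weights $w_i$ and nodes $x_i\in K$. A partition of $\Omega$ is a finite set of boxes covering $\Omega$ with pairwise disjoint interiors. AdaQuad (with marking rule $\mathcal M$ and refinement rule $\mathcal R$): $\mathcal P_0=\{\Omega\}$; given $\mathcal P_n$, set $\eta_K=w(F(K))\mathrm{vol}(K)$, $\widetilde{\mathcal P}_n=\mathcal M(\mathcal P_n,(\eta_K))$, $\mathcal P_{n+1}=(\mathcal P_n\setminus\widetilde{\mathcal P}_n)\cup\bigcup_{K\in\widetilde{\mathcal P}_n}\mathcal R(K)$; outputs $\mathrm Q_n=\sum_{K\in\mathcal P_n}\mathcal I(f,K)$, $\eta_n=\sum_{K\in\mathcal P_n}w(F(K))\mathrm{vol}(K)$. $\mathrm{D\ddot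 orfler}_\theta$: starting from the empty marked set, repeatedly add to the marked set all unmarked elements whose indicator equals the maximum indicator among unmarked elements, as long as the sum of marked indicators is $<\theta$ times the total sum of indicators; return the marked set. $\mathrm{H\ddot older}_\rho$: for a box $K=K_1\times\dots\times K_d$ with $\eta_K=w(F(K))\mathrm{vol}(K)$: if $\eta_K=0$ return $\{K\}$; otherwise, for each $i$ let $l_i=w(K_i)$ and $m_i=\lceil l_i(C\,\mathrm{vol}(K)/(\rho\eta_K))^{1/\gamma}\rceil$, split $K_i$ into $m_i$ equal consecutive closed subintervals, and return the set of all $\prod_im_i$ product boxes formed from these subintervals. *)

(* Defs.v *)
From HB Require Import structures.
From mathcomp Require Import all_boot all_order all_algebra.
From mathcomp Require Import finmap.
From mathcomp Require Import all_classical all_reals all_analysis.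
Set Implicit Arguments.
Unset Strict Implicit.
Unset Printing Implicit Defensive.
Import Order.TTheory GRing.Theory Num.Theory.
Import numFieldNormedType.Exports.
Local Open Scope classical_set_scope.
Local Open Scope ring_scope.

Section AdaQuad.
Variables (R : realType) (d : nat).

(* A box K = K_1 x ... x K_d in R^d, given by its lower and upper corners. *)
Definition box := ('rV[R]_d * 'rV[R]_d)%type.

Definition blo (K : box) (i : 'I_d) : R := K.1 0 i.
Definition bhi (K : box) (i : 'I_d) : R := K.2 0 i.
Definition blen (K : box) (i : 'I_d) : R := bhi K i - blo K i.

Definition isbox (K : box) : Prop := forall i, blo K i <= bhi K i.

Definition bset (K : box) : set 'rV[R]_d :=
  [set x | forall i, blo K i <= x 0 i <= bhi K i].

Definition subbox_of (Om K : box) : Prop := isbox K /\ bset K `<=` bset Om.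

Definition bwidth (K : box) : R := \big[Num.max/0]_(i < d) blen K i.
Definition bvol (K : box) : R := \prod_(i < d) blen K i.

Definition iwidth (I : R * R) : R := I.2 - I.1.
Definition iset (I : R * R) : set R := [set y | I.1 <= y <= I.2].

Definition interval_enclosure (Om : box) (f : 'rV[R]_d -> R)
    (F : box -> R * R) : Prop :=
  (forall K K', subbox_of Om K -> subbox_of Om K' -> bset K' `<=` bset K ->
     iset (F K') `<=` iset (F K)) /\
  (forall K, subbox_of Om K -> f @` bset K `<=` iset (F K)).

Definition holder_enclosure (Om : box) (F : box -> R * R) (C gam : R) : Prop :=
  forall K, subbox_of Om K -> iwidth (F K) <= C * (bwidth K) `^ gam.

Definition quad_rule := box -> seq (R * 'rV[R]_d).

Definition quad (Q : quad_rule) (f : 'rV[R]_d -> R) (K : box) : R :=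
  \sum_(p <- Q K) p.1 * f p.2.

Definition good_quad_rule (Om : box) (Q : quad_rule) : Prop :=
  forall K, subbox_of Om K ->
    (forall p, p \in Q K -> 0 < p.1 /\ bset K p.2) /\
    \sum_(p <- Q K) p.1 = bvol K.

Definition eta (F : box -> R * R) (K : box) : R := iwidth (F K) * bvol K.

Definition box0 : box := (0, 0).

(* Doerfler marking: starting from the empty set, repeatedly add all unmarked
   elements with maximal indicator, as long as the marked sum is < theta times
   the total sum.  Each active round adds at least one element, so #|P| rounds
   suffice. *)
Definition dorfler_round (theta : R) (e : box -> R) (P M : {fset box})
    : {fset box} :=
  let U := (P `\` M)%fset in
  let mx := \big[Num.max/e (head box0 U)]_(K <- U) e K in
  if (\sum_(K <- M) e K < theta * \sum_(K <- P) e K) && (U != fset0)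
  then (M `|` [fset K in U | e K == mx])%fset
  else M.

Definition dorfler (theta : R) (e : box -> R) (P : {fset box}) : {fset box} :=
  iter #|` P| (dorfler_round theta e P) fset0.

Definition piece (K : box) (m : 'I_d -> nat) (j : 'I_d -> nat) : box :=
  (\row_i (blo K i + (j i)%:R * blen K i / (m i)%:R),
   \row_i (blo K i + (j i).+1%:R * blen K i / (m i)%:R)).

Definition holder_refine (F : box -> R * R) (C gam rho : R) (K : box)
    : {fset box} :=
  let e := eta F K in
  if e == 0 then [fset K]%fset else
  let m := fun i : 'I_d =>
    `|Num.ceil (blen K i * (C * bvol K / (rho * e)) `^ gam^-1)|%N in
  let N := (\max_(i < d) m i)%N in
  [fset piece K m (fun i => nat_of_ord (j i))
     | j : {ffun 'I_d -> 'I_N} in [pred j : {ffun 'I_d -> 'I_N} | [forall i, (j i < m i)%N]]]%fset.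

Definition adaquad_step (F : box -> R * R) (C gam theta rho : R)
    (P : {fset box}) : {fset box} :=
  let M := dorfler theta (eta F) P in
  ((P `\` M) `|` \big[fsetU/fset0]_(K <- M) holder_refine F C gam rho K)%fset.

Definition adaquad_part (Om : box) (F : box -> R * R) (C gam theta rho : R)
    (n : nat) : {fset box} :=
  iter n (adaquad_step F C gam theta rho) [fset Om]%fset.

Definition adaquad_Q (Q : quad_rule) (f : 'rV[R]_d -> R) (Om : box)
    (F : box -> R * R) (C gam theta rho : R) (n : nat) : R :=
  \sum_(K <- adaquad_part Om F C gam theta rho n) quad Q f K.

Definition adaquad_eta (Om : box) (F : box -> R * R) (C gam theta rho : R)
    (n : nat) : R :=
  \sum_(K <- adaquad_part Om F C gam theta rho n) eta F K.

(* Integral over a box, as the iterated (Lebesgue) integral over the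
   coordinate intervals (equals the d-dimensional Lebesgue integral for
   continuous integrands, by Fubini). *)
Definition rv_upd (x : 'rV[R]_d) (i : 'I_d) (t : R) : 'rV[R]_d :=
  \row_j (if j == i then t else x 0 j).

Fixpoint iter_int (K : box) (s : seq 'I_d) (g : 'rV[R]_d -> R)
    (x : 'rV[R]_d) : R :=
  match s with
  | [::] => g x
  | i :: s' => Rintegral lebesgue_measure `[blo K i, bhi K i]
                 (fun t => iter_int K s' g (rv_upd x i t))
  end.

Definition box_integral (K : box) (g : 'rV[R]_d -> R) : R :=
  iter_int K (enum 'I_d) g 0.

End AdaQuad.

(* Main.v *)
(* On a box K both the integral of f and the quadrature value lie between
   vol(K) times the end points of F(K), so the error on K is at most eta_K;
   summing over the partition gives the a posteriori bound, once the integral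
   is known to be additive under the grid refinements.  The subdivision counts
   m_i are chosen so that every piece L of a marked K has
   C w(L)^gam <= rho w(F(K)), hence the pieces of K have total indicator at most
   rho eta_K.  As the marked boxes carry at least the fraction theta of the total
   indicator, one step multiplies it by at most 1 - theta (1 - rho). *)
Require Import Defs.
From HB Require Import structures.
From mathcomp Require Import all_boot all_order all_algebra.
From mathcomp Require Import finmap.
From mathcomp Require Import all_classical all_reals all_analysis.
From mathcomp Require Import ring lra.
Import Order.TTheory GRing.Theory Num.Theory.
Import numFieldNormedType.Exports.
Local Open Scope classical_set_scope.
Local Open Scope ring_scope.

Set Implicit Arguments.
Unset Strict Implicit.
Unset Printing Implicit Defensive.

(** * Uniform continuity on boxes and its inheritance by partial integrals *)

Section UniformContinuity.
Context {R : realType} {d : nat}.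
Implicit Types (Om K : box R d) (f g : 'rV[R]_d -> R) (x y : 'rV[R]_d).

(** Every inner function of an iterated integral must again be integrable. Uniform continuity is the
    invariant that survives integrating out one variable; the coordinatewise distance suits updates
    by [rv_upd]. *)
Definition ucont Om g := forall e : R, 0 < e -> exists2 r : R, 0 < r &
  forall x y, bset Om x -> bset Om y ->
    (forall j, `|x 0 j - y 0 j| < r) -> `|g x - g y| <= e.

Lemma bset_compact Om : compact (bset Om).
Proof.
suff -> : bset Om =
    [set v | forall i, `[blo Om i, bhi Om i]%classic (v ord0 i)].
  apply: (@rV_compact R d (fun i => `[blo Om i, bhi Om i]%classic)) => i.
  exact: segment_compact.
by apply/seteqP; split => x /= + i => /(_ i); rewrite in_itv.
Qed.

Lemma mx_ballP x y (r : R) : 0 < r ->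
  ball x r y <-> forall j, `|x 0 j - y 0 j| < r.
Proof.
move=> r0; rewrite mx_norm_ball /ball_ /= {1}/Num.norm /= mx_normrE; split.
  move=> /bigmax_ltP[_ h] j; have := h (0, j) isT; by rewrite !mxE.
move=> h; apply/bigmax_ltP; split=> // -[i j] _; rewrite !mxE (ord1 i); exact: h.
Qed.

(** Heine's theorem. Compactness is used in its near-covering form, with the modulus [r] running
    along the filter [0^'+]: a modulus valid near each point yields one valid on the whole box. *)
Lemma within_continuous_ucont Om f :
  {within bset Om, continuous f} -> ucont Om f.
Proof.
move=> /subspace_continuousP cf e e0.
have /compact_near_coveringP cpt := @bset_compact Om.
have {}cpt := cpt _ (0:R)^'+ (fun r x => bset Om x -> forall y, bset Om y ->
  (forall j, `|x 0 j - y 0 j| < r) -> `|f x - f y| <= e).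
have e20 : 0 < e / 2 by rewrite divr_gt0.
have [|r /= r0 hr] := cpt _.
  move=> x Kx; have /cvgrPdist_lt/(_ _ e20) := cf x Kx.
  rewrite near_withinE => /nbhs_ballP[r /= r0 hr].
  have r20 : 0 < r / 2 by rewrite divr_gt0.
  (* With both distances below [r / 2], [x'] and [y] lie within [r] of the centre [x], where [f]
     varies by less than [e / 2]. *)
  exists (ball x (r / 2), [set t : R | 0 < t < r / 2]) => /=.
    split; first exact: nbhsx_ballx.
    by near=> t; apply/andP; split; near: t; [exact: nbhs_right_gt|exact: nbhs_right_lt].
  move=> [x' t] /= [xx' /andP[t0 tr]] Kx' y Ky x'y.
  have bx' : ball x r x' by apply: le_ball xx'; lra.
  have x'y2 : ball x' (r / 2) y.
    by apply/mx_ballP => // j; apply: lt_trans (x'y j) _.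
  have bxy : ball x r y by rewrite [r]splitr; apply: ball_triangle xx' x'y2.
  have : `|f x - f x'| < e / 2 := hr _ bx' Kx'.
  have : `|f x - f y| < e / 2 := hr _ bxy Ky.
  rewrite /= !ltr_norml ler_norml => /andP[? ?] /andP[? ?].
  by apply/andP; split; lra.
exists (r / 2); first by rewrite divr_gt0.
move=> x y Kx Ky; apply: (hr (r / 2)) => //=; last by rewrite divr_gt0.
by rewrite sub0r normrN gtr0_norm ?divr_gt0//; lra.
Unshelve. all: by end_near. Qed.

Lemma bset_upd Om x i t : bset Om x -> blo Om i <= t <= bhi Om i ->
  bset Om (rv_upd x i t).
Proof. by move=> Kx ht j; rewrite mxE; case: eqP => [->|]. Qed.

Lemma ucont_slice Om g x i : ucont Om g -> bset Om x ->
  {within `[blo Om i, bhi Om i], continuous (fun t => g (rv_upd x i t))}.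
Proof.
move=> ug Kx; apply/subspace_continuousP => t /=; rewrite in_itv /= => ht.
apply/cvgrPdist_le => e e0; have [r r0 hr] := ug e e0.
rewrite near_withinE; apply/nbhs_ballP; exists r => //= s ts.
rewrite in_itv /= => hs; apply: hr; [exact: bset_upd..|].
by move=> j; rewrite !mxE; case: eqP => // _; rewrite subrr normr0.
Qed.

Lemma ucont_integrable Om g x i a b : ucont Om g -> bset Om x ->
  blo Om i <= a -> b <= bhi Om i ->
  (@lebesgue_measure R).-integrable `[a, b]
    (EFin \o (fun t => g (rv_upd x i t))).
Proof.
move=> ug Kx la bh; apply: continuous_compact_integrable.
  exact: segment_compact.
have := ucont_slice (i := i) ug Kx; apply: continuous_subspaceW.
by move=> t /=; rewrite !in_itv /= => /andP[? ?]; apply/andP; split; lra.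
Qed.

Lemma Rintegral_itv_bounds (h : R -> R) a b c1 c2 : a <= b ->
  (@lebesgue_measure R).-integrable `[a, b] (EFin \o h) ->
  (forall t, a <= t <= b -> c1 <= h t <= c2) ->
  c1 * (b - a) <= Rintegral lebesgue_measure `[a, b] h <= c2 * (b - a).
Proof.
move=> ab ih hc.
have cst (c : R) : c * (b - a) = Rintegral lebesgue_measure `[a, b] (fun=> c).
  rewrite Rintegral_cst//= lebesgue_measure_itv/= lte_fin.
  by move: ab; rewrite le_eqVlt => /predU1P[->|->]; rewrite ?ltxx ?subrr.
have icst (c : R) : (@lebesgue_measure R).-integrable `[a, b] (EFin \o (fun=> c)).
  apply: continuous_compact_integrable; first exact: segment_compact.
  by move=> ?; exact: cst_continuous.
by rewrite !cst; apply/andP; split; apply: le_Rintegral => // t /=;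
  rewrite in_itv /= => /hc/andP[].
Qed.

(** The slices through two close points differ by a uniformly small amount, and integration
    multiplies this by at most [b - a]. *)
Lemma ucont_Rintegral Om g i a b : ucont Om g ->
  blo Om i <= a -> a <= b -> b <= bhi Om i ->
  ucont Om (fun x => Rintegral lebesgue_measure `[a, b]
                       (fun t => g (rv_upd x i t))).
Proof.
move=> ug la ab bh e e0.
(* The [+ 1] keeps the denominator positive when [a = b]. *)
have e'0 : 0 < e / (b - a + 1) by rewrite divr_gt0//; lra.
have [r r0 hr] := ug _ e'0; exists r => // x y Kx Ky xy.
have ix := ucont_integrable ug Kx la bh.
have iy := ucont_integrable ug Ky la bh.
rewrite -RintegralB//.
have := @Rintegral_itv_bounds (fun t => g (rv_upd x i t) - g (rv_upd y i t))
  a b (- (e / (b - a + 1))) (e / (b - a + 1)) ab.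
have le_e : e / (b - a + 1) * (b - a) <= e.
  by rewrite mulrAC ler_pdivrMr; [nra|lra].
case/(_ _ _)/andP => [|t /andP[ta tb]|h1 h2]; last first.
- by rewrite ler_norml; apply/andP; split; lra.
- rewrite -ler_norml; apply: hr; [by apply: bset_upd => //; lra..|].
  by move=> j; rewrite !mxE; case: eqP => // _; rewrite subrr normr0.
- apply: eq_integrable (integrableB _ ix iy) => //.
Qed.

End UniformContinuity.

(** * Iterated integrals: bounds and additivity under grid subdivision *)

Section IteratedIntegral.
Context {R : realType} {d : nat}.
Implicit Types (Om K : box R d) (f g : 'rV[R]_d -> R) (x y : 'rV[R]_d).

Lemma Rintegral_itv_chain (h : R -> R) (c : nat -> R) n :
  (forall k, c k <= c k.+1) ->
  (@lebesgue_measure R).-integrable `[c 0%N, c n] (EFin \o h) ->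
  Rintegral lebesgue_measure `[c 0%N, c n] h =
  \sum_(k < n) Rintegral lebesgue_measure `[c k, c k.+1] h.
Proof.
move=> cS; have c0 k : c 0%N <= c k by elim: k => // k /le_trans; apply.
elim: n => [|n IH] ih.
  by rewrite set_itv1 Rintegral_set1 big_ord0.
have ih' : (@lebesgue_measure R).-integrable `[c 0%N, c n] (EFin \o h).
  by apply: integrableS ih => //; apply: subset_itvl; rewrite bnd_simp.
have ih2 : (@lebesgue_measure R).-integrable `]c n, c n.+1] (EFin \o h).
  by apply: integrableS ih => //; apply: subset_itvr; rewrite bnd_simp.
(* Cutting at [c n] leaves the half-open interval []c n, c n.+1]]; its missing end point does not
   affect the integral. *)
rewrite big_ord_recr /= -IH// -(Rintegral_itv_obnd_cbnd ih2)//.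
have <- := @Rintegral_itvB R h (BLeft (c 0%N)) (BRight (c n.+1)) (c n) ih.
- by rewrite addrC subrK.
- by rewrite bnd_simp.
- by rewrite bnd_simp.
Qed.

Lemma Rintegral_sum (I : Type) (r : seq I) (P : pred I) (a b : R)
    (h : I -> R -> R) :
  (forall i, P i -> (@lebesgue_measure R).-integrable `[a, b] (EFin \o h i)) ->
  Rintegral lebesgue_measure `[a, b] (fun t => \sum_(i <- r | P i) h i t) =
  \sum_(i <- r | P i) Rintegral lebesgue_measure `[a, b] (h i).
Proof.
move=> ih.
have isum s' : (@lebesgue_measure R).-integrable `[a, b]
    (EFin \o (fun t => \sum_(i <- s' | P i) h i t)).
  have /(_ (measurable_itv _)) := fun m => integrable_sum m s' ih.
  by apply: eq_integrable => // t _ /=; rewrite sumEFin.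
elim: r => [|i r IH].
  under eq_Rintegral do rewrite big_nil.
  by rewrite big_nil Rintegral_cst// mul0r.
under eq_Rintegral do rewrite big_cons.
rewrite big_cons; case: ifPn => // Pi.
by rewrite RintegralD ?IH//; exact: ih.
Qed.

(** Sub-boxes with nonempty interior, compared by corners. Strictness gives positive volumes to
    divide by and prevents a box from being separated from itself. *)
Definition cell Om K :=
  forall i, [/\ blo Om i <= blo K i, blo K i < bhi K i & bhi K i <= bhi Om i].

Lemma cell_refl Om : (forall i, blo Om i < bhi Om i) -> cell Om Om.
Proof. by move=> h i; split. Qed.

Lemma cell_sub Om K : cell Om K -> bset K `<=` bset Om.
Proof.
move=> cK x Kx i; have [? ? ?] := cK i; have /andP[? ?] := Kx i.
by apply/andP; split; lra.
Qed.

Lemma cell_subbox Om K : cell Om K -> subbox_of Om K.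
Proof. by move=> cK; split; [move=> i; have [_ /ltW] := cK i|exact: cell_sub]. Qed.

Lemma cell_trans Om K K' : cell Om K -> cell K K' -> cell Om K'.
Proof.
by move=> c1 c2 i; have [? ? ?] := c1 i; have [? ? ?] := c2 i; split; lra.
Qed.

Lemma cell_lo Om K : cell Om K -> bset K K.1.
Proof. by move=> cK i; have [_ ? _] := cK i; rewrite lexx ltW. Qed.

Lemma blen_gt0 Om K i : cell Om K -> 0 < blen K i.
Proof. by move=> cK; have [_ ? _] := cK i; rewrite subr_gt0. Qed.

Lemma bvol_gt0 Om K : cell Om K -> 0 < bvol K.
Proof. by move=> cK; apply: prodr_gt0 => i _; exact: blen_gt0 cK. Qed.

(** Coordinates in [s] are overwritten by the integration variables, and only the sides of the box
    along [s] are ever read. *)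
Lemma iter_int_ext K K' s g x y :
  (forall i, i \in s -> blo K i = blo K' i /\ bhi K i = bhi K' i) ->
  (forall i, i \notin s -> x 0 i = y 0 i) ->
  iter_int K s g x = iter_int K' s g y.
Proof.
elim: s x y => [|i s IH] x y Ks xy /=.
  by congr g; apply/rowP => i; exact: xy.
have [-> ->] := Ks i (mem_head _ _).
apply: eq_Rintegral => t _; apply: IH => [j js|j js].
  by apply: Ks; rewrite inE js orbT.
by rewrite !mxE; case: eqP => // /eqP ji; apply: xy; rewrite inE negb_or ji.
Qed.

Lemma iter_int_ucont Om K s g : cell Om K -> ucont Om g ->
  ucont Om (iter_int K s g).
Proof.
move=> cK ug; elim: s => [|i s IH] //=.
by have [? /ltW ? ?] := cK i; apply: ucont_Rintegral.
Qed.

Lemma iter_int_bounds Om K s g x c1 c2 : cell Om K -> ucont Om g ->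
  (forall y, bset K y -> c1 <= g y <= c2) -> bset K x ->
  c1 * \prod_(i <- s) blen K i <= iter_int K s g x
    <= c2 * \prod_(i <- s) blen K i.
Proof.
move=> cK ug gc; elim: s x => [|i s IH] x Kx /=.
  by rewrite big_nil !mulr1; exact: gc.
have [? /ltW ? ?] := cK i.
rewrite big_cons [blen K i * _]mulrC !mulrA; apply: Rintegral_itv_bounds => //.
  by apply: ucont_integrable (cell_sub cK Kx) _ _ => //; exact: iter_int_ucont.
by move=> t ht; apply: IH; exact: bset_upd.
Qed.

(* All coordinates get overwritten, so the base point of the iterated integral
   may be moved from 0 into the box. *)
Lemma box_integralE K g x : box_integral K g = iter_int K (enum 'I_d) g x.
Proof. by apply: iter_int_ext => // i; rewrite mem_enum. Qed.

Lemma box_integral_bounds Om K g c1 c2 : cell Om K -> ucont Om g ->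
  (forall y, bset K y -> c1 <= g y <= c2) ->
  c1 * bvol K <= box_integral K g <= c2 * bvol K.
Proof.
move=> cK ug gc; rewrite (box_integralE _ _ K.1) /bvol -[\prod_i _]big_enum.
exact: iter_int_bounds cK ug gc (cell_lo cK).
Qed.

Lemma piece_blo K m j i :
  blo (piece K m j) i = blo K i + (j i)%:R * blen K i / (m i)%:R.
Proof. by rewrite /blo mxE. Qed.

Lemma piece_bhi K m j i :
  bhi (piece K m j) i = blo K i + (j i).+1%:R * blen K i / (m i)%:R.
Proof. by rewrite /bhi mxE. Qed.

Lemma blen_piece K m j i : blen (piece K m j) i = blen K i / (m i)%:R.
Proof. by rewrite /blen piece_blo piece_bhi -/(blen K i) -natr1; ring. Qed.

Lemma piece_cell Om K m j : cell Om K -> (forall i, (j i < m i)%N) ->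
  cell K (piece K m j).
Proof.
move=> cK jm i; have l0 := blen_gt0 i cK.
have m0 : 0 < (m i)%:R :> R by rewrite ltr0n (leq_trans _ (jm i)).
split; rewrite ?piece_blo ?piece_bhi.
- by rewrite lerDl divr_ge0 ?mulr_ge0// ltW.
- by rewrite ltrD2l ltr_pM2r ?invr_gt0// ltr_pM2r// ltr_nat.
- have -> : bhi K i = blo K i + blen K i by rewrite /blen addrC subrK.
  by rewrite lerD2l ler_pdivrMr// mulrC ler_pM2l// ler_nat.
Qed.

(** * Cutting a box into a grid, one coordinate at a time *)

Section Grid.
Variables (N : nat) (m : 'I_d -> nat).
Hypotheses (m_gt0 : forall i, (0 < m i)%N) (m_le : forall i, (m i <= N.+1)%N).

(* Indices of the sub-boxes when only the coordinates in s are subdivided; the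
   other coordinates of j are pinned to 0 so that each sub-box is counted once. *)
Definition grid_idx (s : seq 'I_d) (j : {ffun 'I_d -> 'I_N.+1}) :=
  [forall a, if a \in s then (j a < m a)%N else j a == ord0].

Definition fupd (j : {ffun 'I_d -> 'I_N.+1}) i k : {ffun 'I_d -> 'I_N.+1} :=
  [ffun a => if a == i then k else j a].

Lemma grid_idx_sum i s (phi : {ffun 'I_d -> 'I_N.+1} -> R) : i \notin s ->
  \sum_(j | grid_idx (i :: s) j) phi j =
  \sum_(k < m i) \sum_(j | grid_idx s j) phi (fupd j i (inord k)).
Proof.
move=> is_.
rewrite (big_ord_widen _
  (fun k => \sum_(j | grid_idx s j) phi (fupd j i (inord k))) (m_le i)).
rewrite (partition_big (fun j : {ffun 'I_d -> 'I_N.+1} => j i)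
  (fun k => k < m i)%N) /=; last first.
  by move=> j /forallP/(_ i); rewrite mem_head.
apply: eq_bigr => k ki; rewrite inord_val.
(* Setting entry [i] to [k] and resetting it to [ord0] are inverse bijections between the indices
   for [s] and those for [i :: s] with value [k] at [i]. *)
rewrite (reindex_onto (fun j => fupd j i k) (fun j => fupd j i ord0)) /=; last first.
  move=> j /andP[_ /eqP <-]; apply/ffunP => a; rewrite !ffunE.
  by case: eqP => // ->.
apply: eq_bigl => j; apply/andP/idP => [[/andP[/forallP gj _] /eqP jE]|/forallP gj].
  apply/forallP => a; move: (gj a); rewrite inE ffunE; case: eqP => //= -> _.
  by rewrite (negbTE is_) -jE !ffunE eqxx.
have ji : j i = ord0 by move: (gj i); rewrite (negbTE is_) => /eqP.
split; [apply/andP; split; last by rewrite ffunE eqxx|].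
  apply/forallP => a; rewrite inE ffunE; case: eqP => [->|_] //=; exact: gj.
apply/eqP/ffunP => a; rewrite !ffunE; by case: eqP => // ->.
Qed.

Lemma grid_idx_lt s j : grid_idx s j -> forall i, (j i < m i)%N.
Proof. by move=> /forallP h i; move: (h i); case: ifP => // _ /eqP ->. Qed.

(** Induction on [s]: the outermost interval is cut at the grid points, the induction hypothesis
    splits each slice, and the finite sum is pulled out of the integral. *)
Lemma iter_int_grid Om K s g x : cell Om K -> ucont Om g -> bset Om x ->
  uniq s ->
  iter_int K s g x = \sum_(j : {ffun _ -> _} | grid_idx s j)
    iter_int (piece K m (fun a => j a)) s g x.
Proof.
move=> cK ug; elim: s x => [|i s IH] x Ox /=.
  move=> _; rewrite (big_pred1 [ffun=> ord0])// => j.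
  apply/forallP/eqP => [h|-> a]; last by rewrite ffunE.
  by apply/ffunP => a; rewrite ffunE; apply/eqP; exact: h.
case/andP=> is_ us.
have m0 : (m i)%:R != 0 :> R by rewrite pnatr_eq0 -lt0n.
have [b1 /ltW b2 b3] := cK i.
have l0 := blen_gt0 i cK.
(* The grid points of side [i], running from [blo K i] at 0 to [bhi K i] at [m i]. *)
pose c k := blo K i + k%:R * blen K i / (m i)%:R.
have c0 : c 0%N = blo K i by rewrite /c !mul0r addr0.
have cm : c (m i) = bhi K i by rewrite /c mulrAC divff// mul1r addrC subrK.
have cS k : c k <= c k.+1.
  by rewrite lerD2l -!mulrA ler_wpM2r// ?ler_nat ?leqnSn// divr_ge0// ltW.
have := @Rintegral_itv_chain (fun t => iter_int K s g (rv_upd x i t)) c (m i) cS.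
rewrite c0 cm => ->; last first.
  by apply: (ucont_integrable (Om := Om)) => //; exact: iter_int_ucont.
rewrite grid_idx_sum//; apply: eq_bigr => k _.
have c_ge j : blo K i <= c j by rewrite -c0; elim: j => // j /le_trans; apply.
have c_le j : (j <= m i)%N -> c j <= bhi K i.
  rewrite -cm => /subnKC <-; elim: (m i - j)%N => [|n ih]; first by rewrite addn0.
  by rewrite addnS (le_trans ih).
transitivity (Rintegral lebesgue_measure `[c k, c k.+1]
  (fun t => \sum_(j : {ffun _ -> _} | grid_idx s j)
     iter_int (piece K m (fun a => j a)) s g (rv_upd x i t))).
  apply: eq_Rintegral => t; rewrite inE /= in_itv /= => /andP[t1 t2]; apply: IH => //.
  have := c_ge k; have := c_le k.+1 (ltn_ord k).
  by move=> ? ?; apply: bset_upd => //; apply/andP; split; lra.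
rewrite Rintegral_sum//; last first.
  move=> j /grid_idx_lt jm; have cp := piece_cell cK jm.
  apply: (ucont_integrable (Om := Om)) => //.
  - exact: iter_int_ucont (cell_trans cK cp) ug.
  - by rewrite (le_trans b1).
  - by rewrite (le_trans (c_le k.+1 _)).
apply: eq_bigr => j gj /=; have kN : (k < N.+1)%N := leq_trans (ltn_ord k) (m_le i).
rewrite piece_blo piece_bhi ffunE eqxx inordK//; apply: eq_Rintegral => t _.
(* The inner integral runs over [s], which omits [i], so changing entry [i] of the index does not
   alter it. *)
apply: iter_int_ext => // a as_; rewrite !piece_blo !piece_bhi ffunE.
by case: eqP as_ => // ->; rewrite (negbTE is_).
Qed.

Lemma box_integral_grid Om K g : cell Om K -> ucont Om g ->
  box_integral K g =
  \sum_(j : {ffun 'I_d -> 'I_N.+1} | [forall i, (j i < m i)%N])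
     box_integral (piece K m (fun i => j i)) g.
Proof.
move=> cK ug; rewrite (box_integralE _ _ K.1).
rewrite (iter_int_grid cK ug (cell_sub cK (cell_lo cK)) (enum_uniq _)).
apply: eq_big => [j|j _]; last by rewrite (box_integralE _ _ K.1).
by apply: eq_forallb => i; rewrite mem_enum.
Qed.

End Grid.

End IteratedIntegral.

(** * The marking rule reaches the fraction theta *)

Section Dorfler.
Context {R : realType} {d : nat}.
Variables (theta : R) (e : box R d -> R) (P : {fset box R d}).
Implicit Types M : {fset box R d}.

Lemma bigmax_attained (T : eqType) (s : seq T) (h : T -> R) x0 : x0 \in s ->
  exists2 x, x \in s & h x = \big[Num.max/h x0]_(y <- s) h y.
Proof.
move=> x0s; suff : forall r : seq T, {subset r <= s} ->
    exists2 x, x \in s & h x = \big[Num.max/h x0]_(y <- r) h y by exact.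
elim=> [|y r IH] rs; first by exists x0; rewrite // big_nil.
have [|x xs hx] := IH; first by move=> z zr; apply: rs; rewrite inE zr orbT.
rewrite big_cons -hx; case: (leP (h y) (h x)) => _; first by exists x.
by exists y => //; apply: rs; exact: mem_head.
Qed.

(** The unmarked set is nonempty, so a maximizer of [e] on it exists and gets marked in this
    round. *)
Lemma dorfler_round_proper M : (M `<=` P)%fset ->
  \sum_(K <- M) e K < theta * \sum_(K <- P) e K -> M != P ->
  (M `<` dorfler_round theta e P M)%fset /\
  (dorfler_round theta e P M `<=` P)%fset.
Proof.
move=> MP lt MneP; rewrite /dorfler_round lt /=.
have U0 : (P `\` M)%fset != fset0.
  apply: contraNneq MneP => /eqP; rewrite fsetD_eq0 => PM.
  by rewrite eqEfsubset MP.
rewrite U0; split; last first.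
  apply/fsubsetP => K; rewrite !inE => /orP[/(fsubsetP MP)//|].
  by move=> /andP[/andP[]].
(* The default of the maximum in [dorfler_round] is thus the indicator of a genuine unmarked box,
   not of [box0]. *)
have hU : head (box0 R d) (P `\` M)%fset \in (P `\` M)%fset.
  move: U0; rewrite -cardfs_gt0 -!topredE /= /in_mem /=.
  have : {subset enum_fset (P `\` M)%fset <= (P `\` M)%fset} by [].
  by case: (enum_fset _) => //= a s h _; apply: h; exact: mem_head.
have [K KU eK] := bigmax_attained e hU.
rewrite fproperEneq fsubsetUl andbT; apply/eqP => /fsetP/(_ K).
have := KU; rewrite !inE -eK eqxx => /andP[/negbTE -> ->]; rewrite /= ?eqxx.
by [].
Qed.

(** After [n] rounds either the threshold is reached or at least [n] boxes are marked. With [n] the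
    cardinality of [P], the second case means that all of [P] is marked, which suffices because
    [theta <= 1]. *)
Lemma dorflerP : (forall K, K \in P -> 0 <= e K) -> theta <= 1 ->
  (dorfler theta e P `<=` P)%fset /\
  theta * \sum_(K <- P) e K <= \sum_(K <- dorfler theta e P) e K.
Proof.
move=> e0 th1; have E0 : 0 <= \sum_(K <- P) e K.
  by rewrite big_seq; apply: sumr_ge0.
have thE : theta * \sum_(K <- P) e K <= \sum_(K <- P) e K.
  by rewrite ler_piMl.
suff H n : let M := iter n (dorfler_round theta e P) fset0 in
    (M `<=` P)%fset /\
    (theta * \sum_(K <- P) e K <= \sum_(K <- M) e K \/ (n <= #|` M|)%N).
  have [MP] := H #|` P|; rewrite -/(dorfler theta e P) => -[h|h]; split=> //.
  suff -> : dorfler theta e P = P by [].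
  by apply/eqP; rewrite eqEfcard MP.
elim: n => [|n [/= MP IH]] /=; first by rewrite fsub0set; split=> //; right.
set M := iter n _ _ in MP IH *.
have [h|h] := leP (theta * \sum_(K <- P) e K) (\sum_(K <- M) e K).
  rewrite {1}/dorfler_round {2}/dorfler_round ltNge h /=.
  by split=> //; left; rewrite /dorfler_round ltNge h.
have MneP : M != P by apply: contraTneq h => ->; rewrite -leNgt.
have [pM sM] := dorfler_round_proper MP h MneP.
split=> //; right; case: IH => [|nM]; first by rewrite leNgt h.
exact: leq_ltn_trans nM (fproper_ltn_card pM).
Qed.

End Dorfler.

(** * The refinement rule: separation, additivity and decay of the indicator *)

Section Refinement.
Context {R : realType} {d : nat}.
Implicit Types (Om K L : box R d) (f g : 'rV[R]_d -> R).

(** For cells this expresses disjoint interiors, in a form that passes to sub-cells by comparing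
    corners. *)
Definition sep K K' := exists i, bhi K i <= blo K' i \/ bhi K' i <= blo K i.

Lemma sep_cell K K' L L' : cell K L -> cell K' L' -> sep K K' -> sep L L'.
Proof.
move=> c c' [i h]; exists i; have [? ? ?] := c i; have [? ? ?] := c' i.
by case: h => h; [left|right]; lra.
Qed.

Lemma sep_neq Om K : cell Om K -> ~ sep K K.
Proof. by move=> c [i]; have [_ ? _] := c i; case; lra. Qed.

Lemma piece_sep Om K m (j j' : 'I_d -> nat) : cell Om K ->
  (exists i, j i != j' i) -> sep (piece K m j) (piece K m j').
Proof.
move=> cK; have lt i a b : (a < b)%N ->
    blo K i + a.+1%:R * blen K i / (m i)%:R <= blo K i + b%:R * blen K i / (m i)%:R.
  move=> ab; rewrite lerD2l -!mulrA ler_wpM2r ?ler_nat//.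
  by rewrite divr_ge0 ?ler0n// ltW// (blen_gt0 _ cK).
case=> i; rewrite neq_ltn => /orP[] h; exists i; [left|right];
  by rewrite piece_bhi piece_blo lt.
Qed.

Section Fixed.
Variables (Om : box R d) (F : box R d -> R * R) (C gam rho : R) (f : 'rV[R]_d -> R).
Hypotheses (FE : interval_enclosure Om f F) (C_gt0 : 0 < C)
  (gam_gt0 : 0 < gam) (FH : holder_enclosure Om F C gam) (rho_gt0 : 0 < rho).

Lemma enclosure_le K x : cell Om K -> bset K x -> (F K).1 <= f x <= (F K).2.
Proof. by move=> cK Kx; apply: (FE.2 K (cell_subbox cK)); exists x. Qed.

Lemma iwidth_ge0 K : cell Om K -> 0 <= iwidth (F K).
Proof.
move=> cK; have /andP[? ?] := enclosure_le cK (cell_lo cK).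
by rewrite subr_ge0; lra.
Qed.

Lemma eta_ge0 K : cell Om K -> 0 <= Defs.eta F K.
Proof.
by move=> cK; rewrite mulr_ge0 ?iwidth_ge0// ltW// (bvol_gt0 cK).
Qed.

(** The local [m] of [holder_refine], repeated verbatim so that unfolding the latter can be folded
    back. *)
Definition refine_count K (i : 'I_d) :=
  `|Num.ceil (blen K i * (C * bvol K / (rho * Defs.eta F K)) `^ gam^-1)|%N.

Local Notation refine := (holder_refine F C gam rho).

(** The real number under the ceiling is positive, so its ceiling is a positive integer and the
    absolute value changes nothing. *)
Lemma refine_count_ge K i : cell Om K -> Defs.eta F K != 0 ->
  blen K i * (C * bvol K / (rho * Defs.eta F K)) `^ gam^-1 <= (refine_count K i)%:R
  /\ (0 < refine_count K i)%N.
Proof.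
move=> cK e0; have e_gt0 : 0 < Defs.eta F K by rewrite lt_def e0 eta_ge0.
set z := (X in X <= _); have z0 : 0 < z.
  have vK := bvol_gt0 cK.
  apply: mulr_gt0; first exact: blen_gt0 cK.
  by apply/powR_gt0/divr_gt0; rewrite mulr_gt0.
have c0 : 0 < Num.ceil z by rewrite ceil_gt0.
have -> : (refine_count K i)%:R = (Num.ceil z)%:~R :> R.
  by rewrite -[in RHS](gtz0_abs c0).
by split; [exact: ceil_ge|rewrite absz_gt0 gt_eqF].
Qed.

(** Connects the set produced by [holder_refine] with sums over grid indices. The largest count is
    positive, hence of the form [N.+1], as the grid lemmas require. *)
Lemma refineE K : cell Om K -> Defs.eta F K != 0 ->
  exists N, (forall i, refine_count K i <= N.+1)%N /\
  (forall L, L \in refine K <->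
    exists2 j : {ffun 'I_d -> 'I_N.+1}, (forall i, (j i < refine_count K i)%N) &
      L = piece K (refine_count K) (fun i => j i)) /\
  forall phi : box R d -> R, \sum_(L <- refine K) phi L =
    \sum_(j : {ffun 'I_d -> 'I_N.+1} | [forall i, (j i < refine_count K i)%N])
       phi (piece K (refine_count K) (fun i => j i)).
Proof.
move=> cK e0.
(* in dimension 0 the width is 0, and the Hoelder bound forces eta F K = 0 *)
have [i0 _] : exists i : 'I_d, true.
  case: (posnP d) => [d0|d0]; last by exists (Ordinal d0).
  have w0 : bwidth K = 0.
    by rewrite /bwidth big_pred0// => -[i i0]; exfalso; rewrite d0 in i0.
  have := FH (cell_subbox cK).
  rewrite w0 powR0 ?gt_eqF// mulr0 => wF.
  have wF0 : iwidth (F K) = 0 by apply/eqP; rewrite eq_le wF iwidth_ge0.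
  by move: e0; rewrite /Defs.eta wF0 mul0r eqxx.
have le_max i : (refine_count K i <= \max_(i < d) refine_count K i)%N.
  exact: leq_bigmax.
rewrite /holder_refine (negbTE e0) -/(refine_count K).
have : (0 < \max_(i < d) refine_count K i)%N.
  exact: leq_trans (refine_count_ge i0 cK e0).2 (le_max i0).
move: le_max; case: (\max_(i < d) _)%N => // N le_max _.
exists N; split; [exact: le_max|split=> [L|phi]].
  split=> [/imfsetP[j /= /forallP hj ->]|[j hj ->]]; first by exists j.
  by apply/imfsetP; exists j => //; apply/forallP.
(* Pieces with different indices are separated and therefore distinct, so forming the image set
   loses no summand. *)
rewrite big_imfset /=; last first.
  move=> j j' /forallP hj /forallP hj' E; apply/ffunP => i; apply/eqP.
  apply: contrapT => /negP ne.
  have : sep (piece K (refine_count K) (fun i => j i))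
             (piece K (refine_count K) (fun i => j' i)).
    by apply: piece_sep cK _; exists i.
  by rewrite E; apply: sep_neq; exact: piece_cell.
by rewrite -[RHS]big_enum.
Qed.

Lemma refine_cell K L : cell Om K -> L \in refine K -> cell K L.
Proof.
move=> cK; have [e0|e0] := eqVneq (Defs.eta F K) 0.
  rewrite /holder_refine e0 eqxx inE => /eqP ->; apply: cell_refl => i.
  by have [] := cK i.
by have [N [_ [-> _]]] := refineE cK e0; case=> j hj ->; exact: piece_cell cK hj.
Qed.

Lemma refine_sep K L L' : cell Om K -> L \in refine K -> L' \in refine K ->
  L != L' -> sep L L'.
Proof.
move=> cK; have [e0|e0] := eqVneq (Defs.eta F K) 0.
  by rewrite /holder_refine e0 eqxx !inE => /eqP -> /eqP ->; rewrite eqxx.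
have [N [_ [mem _]]] := refineE cK e0.
move=> /mem[j _ ->] /mem[j' _ ->] ne; apply: piece_sep cK _.
apply: contrapT => h; move/eqP: ne; apply; congr piece; apply/funext => i.
by apply/eqP; apply: contrapT => /negP hi; apply: h; exists i.
Qed.

Lemma refine_integral K g : cell Om K -> ucont Om g ->
  \sum_(L <- refine K) box_integral L g = box_integral K g.
Proof.
move=> cK ug; have [e0|e0] := eqVneq (Defs.eta F K) 0.
  by rewrite /holder_refine e0 eqxx big_seq_fset1.
have [N [le_N [_ ->]]] := refineE cK e0.
rewrite (box_integral_grid _ le_N cK ug)// => i.
exact: (refine_count_ge i cK e0).2.
Qed.

Lemma box_integral_cst1 K : cell Om K -> box_integral K (fun=> 1) = bvol K.
Proof.
move=> cK; have := @box_integral_bounds _ _ Om K (fun=> 1) 1 1 cK.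
case/(_ _ _)/andP => [e e0||].
- by exists 1 => // x y _ _ _; rewrite subrr normr0 ltW.
- by move=> y _; rewrite lexx.
- by rewrite mul1r => h1 h2; apply/eqP; rewrite eq_le h2 h1.
Qed.

(** Volume is the integral of 1, so this is an instance of [refine_integral]. *)
Lemma refine_bvol K : cell Om K -> \sum_(L <- refine K) bvol L = bvol K.
Proof.
move=> cK; rewrite -(box_integral_cst1 cK) -refine_integral//; last first.
  by move=> e e0; exists 1 => // x y _ _ _; rewrite subrr normr0 ltW.
apply: eq_big_seq => L LK; rewrite box_integral_cst1//.
exact: cell_trans cK (refine_cell cK LK).
Qed.

(** Put $B = C\,\mathrm{vol}(K)/(\rho\eta_K)$. The counts force $w(L) \le B^{-1/\gamma}$, hence
    $w(F(L)) \le C w(L)^\gamma \le C/B = \rho\eta_K/\mathrm{vol}(K)$. *)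
Lemma refine_eta_le K L : cell Om K -> Defs.eta F K != 0 -> L \in refine K ->
  Defs.eta F L <= rho * Defs.eta F K / bvol K * bvol L.
Proof.
move=> cK e0 LK; have cL := cell_trans cK (refine_cell cK LK).
have vK := bvol_gt0 cK; have vL := bvol_gt0 cL.
have e_gt0 : 0 < Defs.eta F K by rewrite lt_def e0 eta_ge0.
rewrite [leLHS]/Defs.eta ler_pM2r//; apply: le_trans (FH (cell_subbox cL)) _.
pose B := C * bvol K / (rho * Defs.eta F K).
have B0 : 0 < B by apply: divr_gt0; rewrite mulr_gt0.
have A0 : 0 < B `^ gam^-1 by rewrite powR_gt0.
have w0 : 0 <= bwidth L by apply: bigmax_ge_id.
(* Side [i] of [L] is [blen K i] divided by its count, and that count is at least [blen K i] times
   [B] to the power [gam^-1]. *)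
have wA : bwidth L * B `^ gam^-1 <= 1.
  rewrite -ler_pdivlMr// div1r; apply: bigmax_le => [|i _].
    by rewrite invr_ge0 ltW.
  have [N [_ [mem _]]] := refineE cK e0; move/mem: LK => [j _ ->].
  have [mge m0] := refine_count_ge i cK e0.
  by rewrite blen_piece ler_pdivrMr ?ltr0n// ler_pdivlMl// mulrC.
have : (bwidth L * B `^ gam^-1) `^ gam <= 1.
  rewrite -[leRHS](congr1 (@^~ gam) (powR1 R)); apply: ge0_ler_powR;
    by rewrite ?nnegrE ?mulr_ge0// ltW.
rewrite powRM ?powR_ge0// -powRrM mulVf ?gt_eqF// powRr1 ?(ltW B0)//.
rewrite /B mulrA ler_pdivrMr ?mul1r => [h|]; last exact: mulr_gt0.
by rewrite ler_pdivlMr// [leLHS](_ : _ = bwidth L `^ gam * (C * bvol K)) //; ring.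
Qed.

(** The bounds of [refine_eta_le] are proportional to the volumes of the pieces, which add up to
    that of [K]. If the indicator is zero, [K] is kept and both sides vanish. *)
Lemma refine_eta K : cell Om K ->
  \sum_(L <- refine K) Defs.eta F L <= rho * Defs.eta F K.
Proof.
move=> cK; have [e0|e0] := eqVneq (Defs.eta F K) 0.
  by rewrite /holder_refine e0 eqxx big_seq_fset1 e0 mulr0.
apply: (@le_trans _ _ (\sum_(L <- refine K) rho * Defs.eta F K / bvol K * bvol L)).
  rewrite big_seq [leRHS]big_seq; apply: ler_sum => L; exact: refine_eta_le.
by rewrite -mulr_sumr refine_bvol// divfK// gt_eqF// (bvol_gt0 cK).
Qed.

End Fixed.
End Refinement.

(** * Invariants of the adaptive loop, error bound and contraction *)

Section Convergence.
Context {R : realType} {d : nat}.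
Variables (Om : box R d) (F : box R d -> R * R) (C gam rho theta : R).
Variables (f : 'rV[R]_d -> R) (Q : quad_rule R d).
Hypotheses (FE : interval_enclosure Om f F) (C_gt0 : 0 < C)
  (gam_gt0 : 0 < gam) (FH : holder_enclosure Om F C gam) (rho_gt0 : 0 < rho)
  (uf : ucont Om f) (Qgood : good_quad_rule Om Q)
  (theta_le1 : theta <= 1) (rho_le1 : rho <= 1).
Implicit Types (K L : box R d) (P : {fset box R d}).

Local Notation refine := (holder_refine F C gam rho).
Local Notation step := (adaquad_step F C gam theta rho).

(** The nodes lie in [K], so the sampled values lie in [F K]; the weights are positive with total
    [bvol K]. *)
Lemma quad_bounds K : cell Om K ->
  (F K).1 * bvol K <= quad Q f K <= (F K).2 * bvol K.
Proof.
move=> cK; have [Qw <-] := Qgood (cell_subbox cK).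
rewrite !mulr_sumr /quad !big_seq; apply/andP; split; apply: ler_sum => p pQ;
  have [w0 Kp] := Qw p pQ; have /andP[? ?] := enclosure_le FE cK Kp;
  by rewrite [_ * p.1]mulrC ler_pM2l.
Qed.

Lemma quad_error K : cell Om K ->
  `|box_integral K f - quad Q f K| <= Defs.eta F K.
Proof.
move=> cK; have /andP[q1 q2] := quad_bounds cK.
have /andP[i1 i2] := box_integral_bounds cK uf (fun x => enclosure_le FE cK (x := x)).
rewrite /Defs.eta /iwidth mulrBl ler_norml; apply/andP; split; lra.
Qed.

(** The loop invariant. Covering of [Om] enters through additivity of the integral of [f], the form
    in which the error bound uses it. *)
Definition partition_of P :=
  [/\ forall K, K \in P -> cell Om K,
      forall K L, K \in P -> L \in P -> K != L -> sep K L &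
      \sum_(K <- P) box_integral K f = box_integral Om f].

Let marked P := dorfler theta (Defs.eta F) P.
(** Counting an unmarked box as its own only child turns a step into one union over [P]. *)
Let children P K := if K \in marked P then refine K else [fset K]%fset.

Lemma marked_sub P : partition_of P -> (marked P `<=` P)%fset.
Proof.
case=> cP _ _.
by have [] := dorflerP (fun K KP => eta_ge0 FE (cP K KP)) theta_le1.
Qed.

Lemma children_cell P K L : cell Om K -> L \in children P K -> cell K L.
Proof.
move=> cK; rewrite /children; case: ifP => _.
  exact: (refine_cell FE C_gt0 gam_gt0 FH rho_gt0 cK).
by rewrite inE => /eqP ->; apply: cell_refl => i; have [] := cK i.
Qed.

Lemma children_sep P K L L' : cell Om K ->
  L \in children P K -> L' \in children P K -> L != L' -> sep L L'.
Proof.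
move=> cK; rewrite /children; case: ifP => _.
  exact: (refine_sep FE C_gt0 gam_gt0 FH rho_gt0 cK).
by rewrite !inE => /eqP -> /eqP ->; rewrite eqxx.
Qed.

Lemma stepE P : partition_of P -> step P = (\bigcup_(K <- P) children P K)%fset.
Proof.
move=> pP; apply/fsetP => L; rewrite /adaquad_step -/(marked P) inE.
apply/orP/bigfcupP => [[|/bigfcupP[K /andP[KM _] LK]]|[K /andP[KP _]]].
- by rewrite inE => /andP[/negbTE LM LP]; exists L; rewrite ?LP// /children LM inE.
- exists K; last by rewrite /children KM.
  by rewrite (fsubsetP (marked_sub pP)).
- rewrite /children; case: ifPn => KM.
    by move=> LK; right; apply/bigfcupP; exists K; rewrite ?KM.
  by rewrite inE => /eqP ->; left; rewrite inE KM.
Qed.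

Lemma mem_step P L : partition_of P -> L \in step P ->
  exists2 K, K \in P & L \in children P K.
Proof. by move=> /stepE -> /bigfcupP[K /andP[KP _] LK]; exists K. Qed.

(** Children of distinct boxes are separated, so the families are disjoint and the set union merges
    no terms. *)
Lemma step_sum P (phi : box R d -> R) : partition_of P ->
  \sum_(L <- step P) phi L = \sum_(K <- P) \sum_(L <- children P K) phi L.
Proof.
move=> pP; rewrite stepE//; have [cP sP _] := pP.
apply: partition_disjoint_bigfcup => K K' KP KP' ne.
apply/fdisjointP => L LK; apply/negP => LK'.
have cL := children_cell (cP K KP) LK.
apply: (sep_neq cL).
exact: sep_cell cL (children_cell (cP K' KP') LK') (sP _ _ KP KP' ne).
Qed.

Lemma partition_step P : partition_of P -> partition_of (step P).
Proof.
move=> pP; have [cP sP iP] := pP; split.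
- move=> L /(mem_step pP)[K KP LK].
  exact: cell_trans (cP K KP) (children_cell (cP K KP) LK).
- move=> L L' /(mem_step pP)[K KP LK] /(mem_step pP)[K' KP' LK'] ne.
  have [E|ne'] := eqVneq K K'.
    by rewrite -E in LK'; exact: children_sep (cP K KP) LK LK' ne.
  have cL := children_cell (cP K KP) LK.
  exact: sep_cell cL (children_cell (cP K' KP') LK') (sP _ _ KP KP' ne').
- rewrite step_sum// -iP; apply: eq_big_seq => K KP.
  rewrite /children; case: ifP => _; last by rewrite big_seq_fset1.
  exact: (refine_integral FE C_gt0 gam_gt0 FH rho_gt0 (cP K KP)).
Qed.

Lemma step_eta P : partition_of P ->
  \sum_(L <- step P) Defs.eta F L <=
  (1 - theta * (1 - rho)) * \sum_(K <- P) Defs.eta F K.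
Proof.
move=> pP; have [cP sP iP] := pP; rewrite step_sum//.
have MP := marked_sub pP.
have [_] := dorflerP (fun K KP => eta_ge0 FE (cP K KP)) theta_le1.
rewrite -/(marked P) => hM.
set E := \sum_(K <- P) Defs.eta F K in hM *.
set EM := \sum_(K <- marked P) Defs.eta F K in hM.
have r0 : 0 <= 1 - rho by rewrite subr_ge0.
(* Refining a marked [K] saves at least [(1 - rho)] times its indicator, and the marked total [EM]
   is at least [theta * E]. *)
apply: (@le_trans _ _ (E - (1 - rho) * EM)); last first.
  have -> : (1 - theta * (1 - rho)) * E = E - (1 - rho) * (theta * E) by ring.
  by rewrite lerD2l lerN2 ler_wpM2l.
(* Extended by zero to all of [P], the marked sum can be compared box by box. *)
have -> : EM = \sum_(K <- P) (if K \in marked P then Defs.eta F K else 0).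
  rewrite -big_mkcond /= /EM [RHS]big_fset_condE; apply: eq_fbigl => K.
  by rewrite !inE; apply/idP/andP => [KM|[]//]; rewrite (fsubsetP MP).
rewrite mulr_sumr -sumrB big_seq [leRHS]big_seq; apply: ler_sum => K KP.
rewrite /children; case: ifPn => KM; last by rewrite big_seq_fset1 mulr0 subr0.
have := refine_eta FE C_gt0 gam_gt0 FH rho_gt0 (cP K KP).
by move=> h; apply: le_trans h _; lra.
Qed.

Hypothesis (Om_lt : forall i, blo Om i < bhi Om i).

Lemma partition_adaquad n : partition_of (adaquad_part Om F C gam theta rho n).
Proof.
elim: n => [|n IH]; last exact: partition_step.
split=> [K|K L|]; rewrite ?big_seq_fset1// ?inE.
- by move=> /eqP ->; exact: cell_refl.
- by move=> /eqP -> /eqP ->; rewrite eqxx.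
Qed.

Lemma adaquad_error n :
  `|box_integral Om f - adaquad_Q Q f Om F C gam theta rho n|
    <= adaquad_eta Om F C gam theta rho n.
Proof.
have [cP _ <-] := partition_adaquad n.
rewrite -sumrB; apply: le_trans (ler_norm_sum _ _ _) _.
rewrite big_seq [leRHS]big_seq; apply: ler_sum => K /cP; exact: quad_error.
Qed.

Lemma adaquad_eta_ge0 n : 0 <= adaquad_eta Om F C gam theta rho n.
Proof.
have [cP _ _] := partition_adaquad n.
by rewrite /adaquad_eta big_seq; apply: sumr_ge0 => K /cP; exact: (eta_ge0 FE).
Qed.

Lemma adaquad_eta_contract n :
  adaquad_eta Om F C gam theta rho n.+1 <=
  (1 - theta * (1 - rho)) * adaquad_eta Om F C gam theta rho n.
Proof. exact: step_eta (partition_adaquad n). Qed.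

End Convergence.

(** * Geometric decay and conclusion *)

Lemma cvg0_of_contraction (R : realType) (u : nat -> R) (q : R) :
  0 <= q < 1 -> (forall n, 0 <= u n) -> (forall n, u n.+1 <= q * u n) ->
  u n @[n --> \oo] --> (0 : R).
Proof.
move=> /andP[q0 q1] u0 uS.
have uq n : u n <= geometric (u 0%N) q n.
  elim: n => [|n IH]; first by rewrite /= expr0 mulr1.
  apply: le_trans (uS n) _; rewrite /= exprS mulrCA.
  by rewrite ler_wpM2l.
apply: (@squeeze_cvgr _ _ _ _ (fun=> 0) (geometric (u 0%N) q)).
- by near=> n; rewrite u0 uq.
- exact: cvg_cst.
- by apply: cvg_geometric; rewrite ger0_norm.
Unshelve. all: by end_near. Qed.

Unset Implicit Arguments.

Theorem theorem4p1 (R : realType) (d : nat) (theta rho : R)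
  (Q : quad_rule R d) (Om : box R d) (f : 'rV[R]_d -> R)
  (F : box R d -> R * R) (C gam : R) :
  0 < theta < 1 -> 0 < rho < 1 ->
  good_quad_rule Om Q ->
  (forall i, blo Om i < bhi Om i) ->
  {within bset Om, continuous f} ->
  interval_enclosure Om f F ->
  0 < C -> 0 < gam <= 1 ->
  holder_enclosure Om F C gam ->
  (forall n : nat,
     `|box_integral Om f - adaquad_Q Q f Om F C gam theta rho n|
       <= adaquad_eta Om F C gam theta rho n /\
     adaquad_eta Om F C gam theta rho n.+1
       <= (1 - theta * (1 - rho)) * adaquad_eta Om F C gam theta rho n) /\
  (adaquad_eta Om F C gam theta rho n @[n --> \oo] --> 0).
Proof.
move=> /andP[th0 th1] /andP[rho0 rho1] Qg Om_lt /within_continuous_ucont uf FE C0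
  /andP[gam0 _] FH.
have contract n : adaquad_eta Om F C gam theta rho n.+1 <=
    (1 - theta * (1 - rho)) * adaquad_eta Om F C gam theta rho n.
  by apply: (adaquad_eta_contract FE) => //; exact: ltW.
split=> [n|].
  split=> //; apply: (adaquad_error FE) => //; exact: ltW.
apply: (@cvg0_of_contraction _ _ (1 - theta * (1 - rho))) => //.
(* The factor lies in [[0, 1[] because [theta * (1 - rho)] lies strictly between 0 and 1. *)
- by apply/andP; split; nra.
- by move=> n; apply: (adaquad_eta_ge0 FE) => //; exact: ltW.
Qed.
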